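(* Let $n\ge1$, $D=[0,1]^n$, $1\le p\le 3$, and let $\Omega:[0,\infty)\to\mathbb{R}$ be an arbitrary concave univariate MC-type function. Then for every $\mathbf{m}=(m_1,\dots,m_n)\in\mathbb{N}^n$ with $m_i\ge2$ for all $i=1,\dots,n$, $$E_{\mathbf{m}}\left(C_{D,p}(\Omega)\right)=\Omega\left(\frac12\left(\sum_{i=1}^n\frac{1}{m_i^p}\right)^{1/p}\right),$$ where $E_{\mathbf{m}}(C_{D,p}(\Omega))=\sup\{\max_{\mathbf{x}\in D}|f(\mathbf{x})-S_{\mathbf{m}}(f;\mathbf{x})| : f\in C_{D,p}(\Omega)\}$.
   Context: Univariate MC-type function: a function $\Omega$ on $[0,\infty)$ such that (1) $\Omega(0)=0$; (2) $\Omega$ is non-decreasing; (3) $\Omega(\tau+\gamma)\le\Omega(\tau)+\Omega(\gamma)$ for all $\tau,\gamma\ge0$; (4) $\Omega$ is continuous. Modulus of continuity with respect to $p$: with $\|\mathbf{x}-\mathbf{y}\|_p=\left(\sum_{i=1}^n|x_i-y_i|^p\right)^{1/p}$, for continuous $f$ on $D=[0,1]^n$, $$\omega_p(f;\gamma)=\sup\{|f(\mathbf{x})-f(\mathbf{y})| : \mathbf{x},\mathbf{y}\in D,\ \|\mathbf{x}-\mathbf{y}\|_p\le\gamma\},\qquad 0\le\gamma\le n^{1/p}.$$ Class $C_{D,p}(\Omega)$: all continuous $f:D\to\mathbb{R}$ with $\omega_p(f;\gamma)\le\Omega(\gamma)$ for all $0\le\gamma\le n^{1/p}$. Interpolating multilinear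 spline: given $\mathbf{m}\in\mathbb{N}^n$, the nodes are $\mathbf{x}^{\mathbf{j}}=(j_1/m_1,\dots,j_n/m_n)$, $j_i\in\{0,\dots,m_i\}$. For continuous $f$ on $D$, $S_{\mathbf{m}}(f;\cdot)$ is the function on $D$ which on every block $D_{\mathbf{j}}=\prod_{i=1}^n[\frac{j_i}{m_i},\frac{j_i+1}{m_i}]$, $j_i\in\{0,\dots,m_i-1\}$, is a polynomial of degree at most one in each variable $x_i$ separately, and which satisfies $S_{\mathbf{m}}(f;\mathbf{x}^{\mathbf{j}})=f(\mathbf{x}^{\mathbf{j}})$ at all nodes. Explicitly, for $\mathbf{x}\in D_{\mathbf{j}}$, $$S_{\mathbf{m}}(f;\mathbf{x})=\sum_{\mathbf{l}\in\{0,1\}^n} f(\mathbf{x}^{\mathbf{j}+\mathbf{l}})\prod_{i=1}^n H_{l_i,j_i}(x_i),\quad H_{0,j_i}(x_i)=m_i\left(\tfrac{j_i+1}{m_i}-x_i\right),\quad H_{1,j_i}(x_i)=1-H_{0,j_i}(x_i).$$ *)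

(* Defs.v *)
From mathcomp Require Import all_boot all_order all_algebra.
From mathcomp Require Import all_classical all_reals all_analysis.
From mathcomp Require Import ring zify.
Import Order.TTheory GRing.Theory Num.Theory numFieldNormedType.Exports.

Set Implicit Arguments.
Unset Strict Implicit.
Unset Printing Implicit Defensive.

Local Open Scope classical_set_scope.
Local Open Scope ring_scope.

(* A function on [0, +oo) is a total function R -> R, and a function on the
   cube a total function on 'rV[R]_n; the definitions below never depend on the
   values taken outside of [0, +oo) and of the cube. *)

Definition MC_type (R : realType) (Omega : R -> R) : Prop :=
  [/\ Omega 0 = 0,
      (forall x y, 0 <= x -> x <= y -> Omega x <= Omega y),
      (forall x y, 0 <= x -> 0 <= y -> Omega (x + y) <= Omega x + Omega y) &
      {within `[0, +oo[, continuous Omega}].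

Definition concave_on (R : realType) (A : set R) (g : R -> R) : Prop :=
  convex_function (A : set R^o) (fun x => - g x).

Definition cube (R : realType) (n : nat) : set 'rV[R]_n :=
  [set x | forall i, 0 <= x ord0 i <= 1].

Definition pnorm (R : realType) (n : nat) (p : R) (x : 'rV[R]_n) : R :=
  (\sum_i `|x ord0 i| `^ p) `^ p^-1.

(* Suprema are taken in the extended reals, so that they are meaningful without
   a boundedness proof. *)
Definition modulus (R : realType) (n : nat) (p : R) (f : 'rV[R]_n -> R)
    (gamma : R) : \bar R :=
  ereal_sup [set e | exists x y, [/\ cube x, cube y, pnorm p (x - y) <= gamma
                                   & e = `|f x - f y|%:E]].

Definition C_class (R : realType) (n : nat) (p : R) (Omega : R -> R) :
    set ('rV[R]_n -> R) :=
  [set f | {within @cube R n, continuous f} /\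
     forall gamma, 0 <= gamma <= n%:R `^ p^-1 ->
       (modulus p f gamma <= (Omega gamma)%:E)%E].

Definition node (R : realType) (n : nat) (m j : 'I_n -> nat) : 'rV[R]_n :=
  \row_i ((j i)%:R / (m i)%:R).

Definition block (R : realType) (n : nat) (m j : 'I_n -> nat) : set 'rV[R]_n :=
  [set x | forall i, (j i)%:R / (m i)%:R <= x ord0 i <= (j i).+1%:R / (m i)%:R].

Definition hat (R : realType) (l : bool) (mi ji : nat) (t : R) : R :=
  let H0 := mi%:R * (ji.+1%:R / mi%:R - t) in if l then 1 - H0 else H0.

Definition block_spline (R : realType) (n : nat) (m : 'I_n -> nat)
    (f : 'rV[R]_n -> R) (j : 'I_n -> nat) (x : 'rV[R]_n) : R :=
  \sum_(l : {ffun 'I_n -> bool})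
    f (node R m (fun i => j i + l i)%N) *
    \prod_i hat (l i) (m i) (j i) (x ord0 i).

(* The index of a block containing x: floor (m_i * x_i), except that x_i = 1
   belongs to the last block, of index m_i - 1. *)
Definition block_index (R : realType) (n : nat) (m : 'I_n -> nat)
    (x : 'rV[R]_n) (i : 'I_n) : nat :=
  minn (Num.truncn ((m i)%:R * x ord0 i)) (m i).-1.

Definition spline (R : realType) (n : nat) (m : 'I_n -> nat)
    (f : 'rV[R]_n -> R) (x : 'rV[R]_n) : R :=
  block_spline m f (block_index m x) x.

(* max_{x in D} |f x - S_m f x|; max_error_attained below shows that for a
   continuous f this supremum is a maximum. *)
Definition max_error (R : realType) (n : nat) (m : 'I_n -> nat)
    (f : 'rV[R]_n -> R) : \bar R :=
  ereal_sup [set `|f x - spline m f x|%:E | x in @cube R n].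

Definition class_error (R : realType) (n : nat) (m : 'I_n -> nat)
    (F : set ('rV[R]_n -> R)) : \bar R :=
  ereal_sup [set max_error m f | f in F].

Section spline_facts.
Context (R : realType) (n : nat) (m : 'I_n -> nat).
Implicit Types (f : 'rV[R]_n -> R) (x : 'rV[R]_n) (j : 'I_n -> nat).

Lemma cube_block x : (forall i, (0 < m i)%N) -> cube x ->
  (forall i, (block_index m x i < m i)%N) /\ block m (block_index m x) x.
Proof.
move=> m0 Dx; split=> i; first by rewrite gtn_min prednK// leqnn orbT.
have mi0 : 0 < (m i)%:R :> R by rewrite ltr0n.
have /andP[x0 x1] := Dx i.
rewrite ler_pdivrMr// ler_pdivlMr// ![x _ _ * _]mulrC.
have /andP[lo up] := Num.Theory.truncn_itv (mulr_ge0 (ltW mi0) x0).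
apply/andP; split.
  by rewrite (le_trans _ lo)// ler_nat geq_minl.
rewrite /block_index; have [_|_] := leqP; first exact: ltW.
by rewrite prednK// ler_piMr// ltW.
Qed.

Lemma block_cube j x : (forall i, (j i < m i)%N) -> block m j x -> cube x.
Proof.
move=> jm Bx i; have /andP[lo up] := Bx i.
rewrite (le_trans _ lo) ?divr_ge0 ?ler0n//= (le_trans up)//.
have m0 : (0 < m i)%N by apply: leq_ltn_trans (jm i).
by rewrite ler_pdivrMr ?ltr0n// mul1r ler_nat.
Qed.

(* The formulas on adjacent blocks agree on the common face, so the spline is
   the prescribed multilinear function on every closed block. *)
Lemma splineE f j x : (forall i, (j i < m i)%N) -> block m j x ->
  spline m f x = block_spline m f j x.
Proof.
move=> jm Bj; have m0 i : (0 < m i)%N by apply: leq_ltn_trans (jm i).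
have [km Bk] := cube_block m0 (block_cube jm Bj).
rewrite /spline; move: (block_index m x) km Bk => k km Bk.
have mi0 i : (m i)%:R != 0 :> R by rewrite pnatr_eq0 -lt0n.
pose flip (l : {ffun 'I_n -> bool}) : {ffun 'I_n -> bool} :=
  [ffun i => l i (+) (j i != k i)].
have flipK : involutive flip.
  by move=> l; apply/ffunP => i; rewrite !ffunE addbK.
have hat_flip l i : hat (flip l i) (m i) (k i) (x ord0 i) =
      hat (l i) (m i) (j i) (x ord0 i) /\
    (hat (l i) (m i) (j i) (x ord0 i) = 0 \/ (k i + flip l i = j i + l i)%N).
  rewrite /flip ffunE; have [->|jk] := eqVneq (j i) (k i).
    by rewrite addbF; split=> //; right.
  have := Bj i; have := Bk i.
  move: (mi0 i) (m0 i) jk; move: (m i) (j i) (k i) (x ord0 i) (l i) => M a b t e.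
  move=> MN0 M0 ab /andP[bt tb] /andP[at' ta].
  have Mp : 0 < M%:R^-1 :> R by rewrite invr_gt0 ltr0n.
  have : (b <= a.+1)%N by rewrite -(ler_nat R) -(ler_pM2r Mp) (le_trans bt).
  have : (a <= b.+1)%N by rewrite -(ler_nat R) -(ler_pM2r Mp) (le_trans at').
  move=> abS baS.
  have [ba|ba] : b = a.+1 \/ a = b.+1 by move: ab abS baS => /eqP; lia.
    have tE : t = a.+1%:R / M%:R.
      by apply/eqP; rewrite eq_le ta -{1}ba bt.
    subst b t; case: e; rewrite /hat /= -?natr1; split; try (by field);
      by [right; rewrite addn0 addn1|left; field].
  have tE : t = b.+1%:R / M%:R.
    by apply/eqP; rewrite eq_le tb -{1}ba at'.
  subst a t; case: e; rewrite /hat /= -?natr1; split; try (by field);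
    by [right; rewrite addn0 addn1|left; field].
rewrite /block_spline (reindex_inj (inv_inj flipK)); apply: eq_bigr => l _.
have -> : \prod_i hat (flip l i) (m i) (k i) (x ord0 i) =
          \prod_i hat (l i) (m i) (j i) (x ord0 i).
  by apply: eq_bigr => i _; have [] := hat_flip l i.
have [/existsP[i /eqP hi]|/existsPn h0] :=
    boolP [exists i, hat (l i) (m i) (j i) (x ord0 i) == 0].
  by rewrite (bigD1 i)//= hi mul0r !mulr0.
congr (f _ * _); apply/rowP => i; rewrite !mxE.
by have [_ [/eqP|->//]] := hat_flip l i; rewrite (negbTE (h0 i)).
Qed.

Lemma spline_node f j : (forall i, (0 < m i)%N) -> (forall i, (j i <= m i)%N) ->
  spline m f (node R m j) = f (node R m j).
Proof.
move=> m0 jm; pose k i := minn (j i) (m i).-1.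
have mi0 i : (m i)%:R != 0 :> R by rewrite pnatr_eq0 -lt0n.
have Mp i : 0 <= (m i)%:R^-1 :> R by rewrite invr_ge0 ler0n.
pose l0 : {ffun 'I_n -> bool} := [ffun i => j i == m i].
have kl i : (k i + l0 i)%N = j i.
  by rewrite /k ffunE; have := m0 i; have := jm i; case: eqP; lia.
rewrite (@splineE _ k); last first.
- by move=> i; rewrite mxE !ler_wpM2r// ler_nat; have := kl i; case: (l0 i); lia.
- by move=> i; rewrite /k; have := m0 i; lia.
rewrite /block_spline (bigD1 l0)//= [X in _ + X]big1 ?addr0 => [|l ll0].
  rewrite big1 ?mulr1 => [|i _].
    by congr f; apply/rowP => i; rewrite !mxE kl.
  by rewrite mxE -kl /hat; case: (l0 i); rewrite /= ?addn0 ?addn1 -natr1; field.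
have [i li] : exists i, l i != l0 i.
  by apply/existsP; rewrite -negb_forall; apply: contra ll0 => /forallP ll0;
    apply/eqP/ffunP => i; exact/eqP.
rewrite (bigD1 i)//= mxE -kl /hat; move: li.
by case: (l i); case: (l0 i) => //= _; rewrite ?addn0 ?addn1 -natr1; field.
Qed.

Lemma max_error_attained f : (forall i, (0 < m i)%N) ->
  {within @cube R n, continuous f} ->
  exists2 x, cube x & max_error m f = `|f x - spline m f x|%:E.
Proof.
move=> m0 cf.
pose N := \max_i m i.
pose T := {ffun 'I_n -> 'I_N}.
pose nat_of (k : T) i : nat := k i.
pose inside (k : T) := [forall i, (k i < m i)%N].
have mN i : (m i <= N)%N by exact: leq_bigmax.
pose idx (j : 'I_n -> nat) (jm : forall i, (j i < m i)%N) : T :=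
  [ffun i => Ordinal (leq_trans (jm i) (mN i))].
have max_block (k : T) : inside k -> exists2 c, block m (nat_of k) c &
    forall x, block m (nat_of k) x -> `|f x - spline m f x| <= `|f c - spline m f c|.
  move=> /forallP km.
  have B0 : @block R n m (nat_of k) !=set0.
    exists (node R m (nat_of k)) => i; rewrite mxE lexx/=.
    by rewrite ler_wpM2r ?invr_ge0 ?ler0n// ler_nat.
  have cB : compact (@block R n m (nat_of k)).
    have := @rV_compact R n
      (fun i => [set` `[(k i)%:R / (m i)%:R, (k i).+1%:R / (m i)%:R]])
      (fun i => @segment_compact R _ _).
    by congr compact; apply/seteqP; split => x Bx i; have := Bx i;
      rewrite /= in_itv.
  have cfB : {within @block R n m (nat_of k), continuous f}.
    by apply: continuous_subspaceW cf => x; exact: block_cube.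
  have cs : continuous (block_spline m f (nat_of k)).
    apply: continuous_big => [|l _]; first exact: add_continuous.
    move=> x; apply: (continuousM (s := fun=> f _)); first
      exact: cst_continuous.
    apply: continuous_big => [|i _ {}x]; first exact: mul_continuous.
    have cH0 : {for x, continuous (fun y : 'rV[R]_n =>
        (m i)%:R * ((nat_of k i).+1%:R / (m i)%:R - y ord0 i))}.
      apply: (continuousM (s := fun=> _)); first exact: cst_continuous.
      apply: (continuousB (f := fun=> _)); first exact: cst_continuous.
      exact: coord_continuous.
    rewrite /hat; case: (l i) => //.
    by apply: (continuousB (f := fun=> _)) cH0; exact: cst_continuous.
  have [|c /set_mem Bc cmax] :=
      @EVT_max_rV R n (fun x => `|f x - block_spline m f (nat_of k) x|) _ B0 cB.
    move=> x; apply: cvg_norm; apply: cvgB; first exact: cfB.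
    by apply: (continuous_subspaceT cs).
  exists c => // x Bx; rewrite !(splineE f km)//.
  by apply: cmax; exact: mem_set.
pose c (k : T) : 'rV[R]_n :=
  if pselect (inside k) is left kP then sval (cid2 (max_block k kP)) else 0.
have cP k : inside k -> block m (nat_of k) (c k) /\
    forall x, block m (nat_of k) x ->
      `|f x - spline m f x| <= `|f (c k) - spline m f (c k)|.
  by rewrite /c; case: pselect => // kP _; case: cid2.
have k0P : inside (idx (fun=> 0%N) m0) by apply/forallP => i; rewrite ffunE.
case: (@Order.TotalTheory.arg_maxP _ _ _ _ inside
  (fun k => `|f (c k) - spline m f (c k)|) k0P) => k kP kmax.
have [Bc ck] := cP k kP; exists (c k).
  by apply: block_cube Bc => i; exact: (forallP kP).
apply/eqP; rewrite eq_le; apply/andP; split.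
  apply: ge_ereal_sup => _ [x Dx <-]; rewrite lee_fin.
  have [jm Bj] := cube_block m0 Dx.
  have jP : inside (idx _ jm).
    by apply/forallP => i; rewrite ffunE; exact: jm.
  have /= := kmax _ jP; apply: le_trans; apply: (cP _ jP).2.
  by move=> i; rewrite /nat_of ffunE; exact: Bj.
apply: ereal_sup_ubound; exists (c k) => //.
by apply: block_cube Bc => i; exact: (forallP kP).
Qed.

End spline_facts.

(* Main.v *)
(* On a block, f - S f is the average of the differences f x - f (node) over the
   vertices, with the multilinear weights.  Two applications of Jensen's
   inequality, for Omega and for t^p, bound it by Omega of the p-th root of
   sum_i (h_i (1 - h_i)^p + (1 - h_i) h_i^p) / m_i^p, where h_i is the local
   coordinate; for 1 <= p <= 3 each numerator is largest at h_i = 1/2.  The bound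
   is attained by Omega o d, where d is the distance to the set of nodes: it is in
   the class since d is 1-Lipschitz, its spline is 0, and d takes the required
   value at the center of a block. *)
Require Import Defs.
From mathcomp Require Import all_boot all_order all_algebra.
From mathcomp Require Import all_classical all_reals all_analysis.
From mathcomp Require Import ring lra.
Import Order.TTheory GRing.Theory Num.Theory numFieldNormedType.Exports.
Set Implicit Arguments.
Unset Strict Implicit.
Local Open Scope classical_set_scope.
Local Open Scope ring_scope.

(** * Convexity inequalities *)

Lemma convex_half_line (R : realType) (g : R -> R) (a b x y : R) :
  convex_function (`[0, +oo[%classic : set R^o) g ->
  0 <= a -> 0 <= b -> a + b = 1 -> 0 <= x -> 0 <= y ->
  g (a * x + b * y) <= a * g x + b * g y.
Proof.
move=> g_convex a0 b0 ab1 x0 y0.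
have a1 : a <= 1 by rewrite -ab1 lerDl.
have -> : b = 1 - a by rewrite -ab1 addrAC subrr add0r.
by apply: (g_convex (Itv01 a0 a1)); rewrite inE /= in_itv /= andbT.
Qed.

Lemma jensen (R : realType) (I : finType) (g : R -> R) (w x : I -> R) :
  convex_function (`[0, +oo[%classic : set R^o) g ->
  (forall i, 0 <= w i) -> (forall i, 0 <= x i) -> \sum_i w i = 1 ->
  g (\sum_i w i * x i) <= \sum_i w i * g (x i).
Proof.
move=> g_convex w0 x0 w1.
(* The weights of a sublist need not sum to 1, so the induction runs on averages normalised by their
   positive total. *)
suff scaled (r : seq I) : 0 < \sum_(i <- r) w i ->
    g ((\sum_(i <- r) w i * x i) / \sum_(i <- r) w i) <=
    (\sum_(i <- r) w i * g (x i)) / \sum_(i <- r) w i.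
  by have := scaled (index_enum I); rewrite w1 !divr1; apply; exact: ltr01.
elim: r => [|i r IHr]; first by rewrite big_nil ltxx.
rewrite !big_cons; set W := \sum_(j <- r) w j => Wpos.
have : 0 <= W by exact: sumr_ge0.
(* If the tail has total weight 0, all its weights vanish and its average is undefined; only the
   head term remains. *)
rewrite le_eqVlt => /predU1P[W0|W0].
  have wr j : j \in r -> w j = 0.
    move=> jr; have /eqP := esym W0.
    by rewrite psumr_eq0 => [/allP/(_ j jr)/eqP|].
  have zero (h : I -> R) : \sum_(j <- r) w j * h j = 0.
    by rewrite big1_seq// => j /andP[_ /wr ->]; rewrite mul0r.
  have wi : w i != 0 by move: Wpos; rewrite -W0 addr0 => /gt_eqF ->.
  by rewrite !zero -W0 !addr0 ![w i * _]mulrC !mulfK.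
have Wn : w i + W != 0 by rewrite gt_eqF.
have -> : (w i * x i + \sum_(j <- r) w j * x j) / (w i + W) =
    w i / (w i + W) * x i + W / (w i + W) * ((\sum_(j <- r) w j * x j) / W).
  by field; rewrite Wn gt_eqF.
apply: (le_trans (convex_half_line g_convex _ _ _ _ _)) => //.
- by rewrite divr_ge0// ltW.
- by rewrite divr_ge0 ?ltW.
- by rewrite -mulrDl divff.
- by rewrite divr_ge0 ?sumr_ge0 ?ltW// => j _; rewrite mulr_ge0.
have -> : (w i * g (x i) + \sum_(j <- r) w j * g (x j)) / (w i + W) =
    w i / (w i + W) * g (x i) +
    W / (w i + W) * ((\sum_(j <- r) w j * g (x j)) / W).
  by field; rewrite Wn gt_eqF.
by rewrite lerD2l ler_wpM2l ?IHr// divr_ge0 ?ltW.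
Qed.

(* Chord of the convex function [q |-> a `^ q] through q = 1 and q = 3. *)
Lemma powR_le_chord (R : realType) (a p : R) : 0 <= a -> 1 <= p <= 3 ->
  a `^ p <= (3 - p) / 2 * a + (p - 1) / 2 * a ^+ 3.
Proof.
rewrite le_eqVlt => /predU1P[<-|a0] /andP[p1 p3].
  by rewrite powR0 ?gt_eqF ?(lt_le_trans _ p1)// expr0n/= !mulr0 addr0.
have t0 : 0 <= (3 - p) / 2 by lra.
have t1 : (3 - p) / 2 <= 1 by lra.
(* With [a] positive, p = t + 3 (1 - t) for t = (3 - p) / 2, so the claim is convexity of [expR]
   between [ln a] and [3 * ln a]. *)
have := convex_expR (Itv01 t0 t1) (ln a) (ln (a ^+ 3)).
rewrite !convRE /unstable.onem /= !lnK ?posrE ?exprn_gt0// lnXn// => h.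
rewrite /powR gt_eqF//.
have -> : p * ln a =
    (3 - p) / 2 * ln a + (1 - (3 - p) / 2) * (ln a *+ 3).
  by rewrite -mulr_natr; field.
by apply: le_trans h _; rewrite le_eqVlt; apply/orP; left; apply/eqP; field.
Qed.

(** Doubling the bases moves h = 1/2 to the base 1, where the chord bound is an equality. The two
    chords then add up to 1 minus nonnegative multiples of (2h - 1)^2 and (2h - 1)^4, the signs of
    the multiples coming from 1 <= p <= 3. *)
Lemma two_point_powR_le (R : realType) (h p : R) : 0 <= h <= 1 -> 1 <= p <= 3 ->
  h * (1 - h) `^ p + (1 - h) * h `^ p <= 2^-1 `^ p.
Proof.
move=> /andP[h0 h1] p13.
have h'0 : 0 <= 1 - h by rewrite subr_ge0.
have half (a : R) : 0 <= a -> a `^ p = 2^-1 `^ p * (2 * a) `^ p.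
  by move=> a0; rewrite -powRM ?mulr_ge0 ?invr_ge0// mulKf ?pnatr_eq0.
rewrite (half (1 - h))// (half h)// mulrCA [in X in _ + X]mulrCA -mulrDr.
rewrite -[leRHS]mulr1 ler_wpM2l ?powR_ge0//.
have c1 := @powR_le_chord R (2 * (1 - h)) p (mulr_ge0 (ler0n _ 2) h'0) p13.
have c2 := @powR_le_chord R (2 * h) p (mulr_ge0 (ler0n _ 2) h0) p13.
apply: le_trans (lerD (ler_wpM2l h0 c1) (ler_wpM2l h'0 c2)) _.
have -> : h * ((3 - p) / 2 * (2 * (1 - h)) + (p - 1) / 2 * (2 * (1 - h)) ^+ 3) +
    (1 - h) * ((3 - p) / 2 * (2 * h) + (p - 1) / 2 * (2 * h) ^+ 3) =
    1 - (3 - p) / 2 * (2 * h - 1) ^+ 2 - (p - 1) / 2 * (2 * h - 1) ^+ 4.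
  by field.
have /andP[p1 p3] := p13.
rewrite -addrA gerDl -opprD oppr_le0 addr_ge0// mulr_ge0//.
- by rewrite divr_ge0// subr_ge0.
- exact: sqr_ge0.
- by rewrite divr_ge0// subr_ge0.
- by rewrite exprn_even_ge0.
Qed.

Lemma powRV (R : realType) (p a : R) : 0 <= a -> a^-1 `^ p = (a `^ p)^-1.
Proof.
by move=> a0; rewrite -(powR_inv1 a0) powRAC powR_inv1// powR_ge0.
Qed.

Lemma ler_powR2r (R : realType) (p a b : R) : 0 < p -> 0 <= a -> 0 <= b ->
  (a `^ p <= b `^ p) = (a <= b).
Proof.
move=> p0 a0 b0; apply/idP/idP => [|ab]; last first.
  by rewrite ge0_ler_powR ?nnegrE// ltW.
by apply: contraTT; rewrite -!ltNge => ba; rewrite gt0_ltr_powR ?nnegrE.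
Qed.

(** * The p-norm on row vectors *)

Section pnorm_theory.
Context {R : realType} {n : nat} {p : R}.
Hypothesis p1 : 1 <= p.
Implicit Types x y : 'rV[R]_n.

Let p0 : 0 < p. Proof. exact: lt_le_trans p1. Qed.

Let p_ge0 : 0 <= p. Proof. exact: ltW. Qed.

Lemma pnorm_ge0 x : 0 <= pnorm p x.
Proof. exact: powR_ge0. Qed.

Lemma powR_pnorm x : pnorm p x `^ p = \sum_i `|x ord0 i| `^ p.
Proof.
rewrite -powRrM mulVf ?gt_eqF// powRr1//.
by apply: sumr_ge0 => i _; exact: powR_ge0.
Qed.

Lemma pnorm_le x (c : R) : 0 <= c ->
  (pnorm p x <= c) = (\sum_i `|x ord0 i| `^ p <= c `^ p).
Proof. by move=> c0; rewrite -powR_pnorm ler_powR2r// pnorm_ge0. Qed.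

Lemma le_pnorm x y : (forall i, `|x ord0 i| <= `|y ord0 i|) ->
  pnorm p x <= pnorm p y.
Proof.
move=> xy; rewrite pnorm_le ?pnorm_ge0// powR_pnorm; apply: ler_sum => i _.
by rewrite ge0_ler_powR ?nnegrE.
Qed.

Lemma pnorm0 : pnorm p (0 : 'rV[R]_n) = 0.
Proof.
apply/eqP; rewrite eq_le pnorm_ge0 pnorm_le// powR0 ?gt_eqF// big1 ?lexx//.
move=> i _; by rewrite mxE normr0 powR0 ?gt_eqF.
Qed.

Lemma pnorm_eq0 x : pnorm p x = 0 -> x = 0.
Proof.
move=> /powR_eq0_eq0/eqP; rewrite psumr_eq0 => [/allP x0|i _];
  last exact: powR_ge0.
apply/rowP => i; rewrite mxE; apply/normr0_eq0/(@powR_eq0_eq0 R _ p)/eqP.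
by apply: x0; rewrite mem_index_enum.
Qed.

Lemma pnorm_triangle x y : pnorm p (x + y) <= pnorm p x + pnorm p y.
Proof.
(* Convexity of [t |-> t `^ p] applied to [`|x i| / A] and [`|y i| / B] with
   weights [A / (A + B)] and [B / (A + B)]. *)
have [/pnorm_eq0 ->|xN0] := eqVneq (pnorm p x) 0.
  by rewrite pnorm0 !add0r.
have [/pnorm_eq0 ->|yN0] := eqVneq (pnorm p y) 0.
  by rewrite pnorm0 !addr0.
have : 0 < pnorm p x by rewrite lt_neqAle eq_sym xN0 pnorm_ge0.
have : 0 < pnorm p y by rewrite lt_neqAle eq_sym yN0 pnorm_ge0.
rewrite pnorm_le ?addr_ge0 ?pnorm_ge0//.
move: (powR_pnorm x) (powR_pnorm y) xN0 yN0.
move: (pnorm p x) (pnorm p y) => A B xA yB AN0 BN0 B0 A0.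
have AB0 : 0 < A + B by exact: addr_gt0.
apply: (@le_trans _ _ (\sum_i (A + B) `^ p *
    (A / (A + B) * (`|x ord0 i| `^ p / A `^ p) +
     B / (A + B) * (`|y ord0 i| `^ p / B `^ p)))).
  apply: ler_sum => i _.
  have pw (u C : R) : 0 <= u -> 0 < C -> u `^ p / C `^ p = (u / C) `^ p.
    by move=> u0 /ltW C0; rewrite powRM ?invr_ge0// powRV.
  have xA0 : 0 <= `|x ord0 i| / A by rewrite divr_ge0// ltW.
  have yB0 : 0 <= `|y ord0 i| / B by rewrite divr_ge0// ltW.
  have a0 : 0 <= A / (A + B) by rewrite divr_ge0// ltW.
  have b0 : 0 <= B / (A + B) by rewrite divr_ge0// ltW.
  have ab1 : A / (A + B) + B / (A + B) = 1 by rewrite -mulrDl divff// gt_eqF.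
  rewrite !pw//.
  apply: le_trans (ler_wpM2l (powR_ge0 _ _)
    (convex_half_line (convex_powR p1) a0 b0 ab1 xA0 yB0)).
  rewrite -powRM; [|exact: ltW|
    exact: addr_ge0 (mulr_ge0 a0 xA0) (mulr_ge0 b0 yB0)].
  have -> : (A + B) * (A / (A + B) * (`|x ord0 i| / A) +
      B / (A + B) * (`|y ord0 i| / B)) = `|x ord0 i| + `|y ord0 i|.
    by field; rewrite AN0 BN0 gt_eqF.
  by rewrite ge0_ler_powR ?nnegrE ?addr_ge0// mxE ler_normD.
(* After summation both normalised sums are 1 and the two weights add up to 1, which leaves (A +
   B)^p. *)
rewrite -mulr_sumr big_split/= -!mulr_sumr -!mulr_suml -xA -yB.
rewrite !divff ?gt_eqF ?powR_gt0// !mulr1 -mulrDl divff ?gt_eqF// mulr1.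
exact: lexx.
Qed.

Lemma pnormBC x y : pnorm p (x - y) = pnorm p (y - x).
Proof. by congr (_ `^ _); apply: eq_bigr => i _; rewrite !mxE distrC. Qed.

Lemma pnorm_le_sup x (c : R) : 0 <= c -> (forall i, `|x ord0 i| <= c) ->
  pnorm p x <= n%:R `^ p^-1 * c.
Proof.
move=> c0 xc; rewrite pnorm_le ?mulr_ge0 ?powR_ge0// powRM ?powR_ge0//.
rewrite -powRrM mulVf ?gt_eqF// powRr1//.
have -> : n%:R = \sum_(i < n) 1 :> R by rewrite sumr_const card_ord.
by rewrite mulr_suml; apply: ler_sum => i _; rewrite mul1r ler_powR2r.
Qed.

(** The topology on row vectors comes from the maximum norm; this comparison turns [pnorm] estimates
    into continuity. *)
Lemma pnorm_le_norm x : pnorm p x <= n%:R `^ p^-1 * `|x|.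
Proof.
apply: pnorm_le_sup => // i.
rewrite [leRHS]/Num.norm/= mx_normrE; apply/bigmax_geP; right => /=.
by exists (ord0, i).
Qed.

(** Ensures that the range of [gamma] in [C_class] covers every pair of points of the cube. *)
Lemma pnorm_cube x y : cube x -> cube y -> pnorm p (x - y) <= n%:R `^ p^-1.
Proof.
move=> Dx Dy; rewrite -[leRHS]mulr1 pnorm_le_sup// => i; rewrite !mxE.
by have := Dx i; have := Dy i; rewrite ler_norml; lra.
Qed.

End pnorm_theory.

(** * Moduli of continuity and MC-type functions *)

Lemma C_class_le (R : realType) (n : nat) (p : R) (Omega : R -> R)
    (f : 'rV[R]_n -> R) (x y : 'rV[R]_n) :
  1 <= p -> C_class p Omega f -> cube x -> cube y ->
  `|f x - f y| <= Omega (pnorm p (x - y)).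
Proof.
move=> p1 [_ fO] Dx Dy; rewrite -lee_fin.
have xyD : 0 <= pnorm p (x - y) <= n%:R `^ p^-1.
  by rewrite pnorm_ge0 pnorm_cube.
by apply: le_trans (fO _ xyD); apply: ereal_sup_ubound; exists x, y.
Qed.

Section MC_theory.
Context {R : realType} {Omega : R -> R}.
Hypothesis Omega_MC : MC_type Omega.

Lemma MC_ge0 s : 0 <= s -> 0 <= Omega s.
Proof. by case: Omega_MC => O0 O_mono _ _ s0; rewrite -O0 O_mono. Qed.

(** For t <= s this is subadditivity at s = t + (s - t). It carries continuity at 0 to all of the
    half-line. *)
Lemma MC_dist_le s t : 0 <= s -> 0 <= t ->
  `|Omega s - Omega t| <= Omega `|s - t|.
Proof.
wlog ts : s t / t <= s => [wlogts s0 t0|].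
  have [/wlogts|/ltW/wlogts] := leP t s; first exact.
  by rewrite distrC [in X in _ -> X](distrC s); apply.
case: Omega_MC => _ O_mono O_sub _ s0 t0.
rewrite !ger0_norm ?subr_ge0 ?O_mono//.
by rewrite lerBlDl -[in leLHS](subrKC t s) O_sub// subr_ge0.
Qed.

Lemma MC_small e : 0 < e -> exists2 d, 0 < d & Omega d < e.
Proof.
case: Omega_MC => O0 O_mono _ /continuous_within_itvcyP[_ O_cvg] e0.
have /cvgrPdist_lt/(_ e e0) O_near := O_cvg.
have [d [d0 de]] := filter_ex (filterI (nbhs_right_gt 0) O_near).
exists d => //; move: de; rewrite O0 sub0r normrN.
exact/le_lt_trans/ler_norm.
Qed.

End MC_theory.

(** * The extremal function: distance to the grid *)

Section extremal_function.
Context {R : realType} {n : nat} {p : R} {m : 'I_n -> nat}.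
Hypothesis p1 : 1 <= p.
Implicit Types x y : 'rV[R]_n.

(** The index [j] is not bounded by [m], so the grid continues beyond the cube; [node_dist] still
    vanishes at the nodes of the cube, and the extra nodes are no closer to the center used
    below. *)
Definition node_dist x : R :=
  inf [set pnorm p (x - node R m j) | j in [set: 'I_n -> nat]].

Let image_nonempty x :
  [set pnorm p (x - node R m j) | j in [set: 'I_n -> nat]] !=set0.
Proof. by exists (pnorm p (x - node R m (fun=> 0%N))), (fun=> 0%N). Qed.

Lemma node_dist_ge0 x : 0 <= node_dist x.
Proof. by apply: lb_le_inf => // _ [j _ <-]; exact: pnorm_ge0. Qed.

Lemma node_dist_le x j : node_dist x <= pnorm p (x - node R m j).
Proof.
by apply: ge_inf; [exists 0 => _ [k _ <-]; exact: pnorm_ge0 | exists j].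
Qed.

Lemma node_dist_node j : node_dist (node R m j) = 0.
Proof.
apply/eqP; rewrite eq_le node_dist_ge0 andbT.
by rewrite (le_trans (node_dist_le _ j))// subrr pnorm0.
Qed.

(** An infimum of functions that are 1-Lipschitz by the triangle inequality. *)
Lemma node_dist_lipschitz x y :
  `|node_dist x - node_dist y| <= pnorm p (x - y).
Proof.
have half u v : node_dist u - node_dist v <= pnorm p (u - v).
  rewrite lerBlDr addrC -lerBlDr; apply: lb_le_inf => // _ [j _ <-].
  rewrite lerBlDr addrC (le_trans (node_dist_le u j))//.
  by have := pnorm_triangle p1 (u - v) (v - node R m j); rewrite subrKA.
by rewrite ler_norml half lerNl opprB pnormBC half.
Qed.

(** The point is the center of the block at the origin, and the left side is its distance to the
    node 0. Every other node is at least as far in each coordinate. *)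
Lemma node_dist_center : (forall i, (0 < m i)%N) ->
  2^-1 * (\sum_(i < n) 1 / (m i)%:R `^ p) `^ p^-1 <=
  node_dist (\row_i (2 * (m i)%:R)^-1).
Proof.
move=> m0; have p0 : 0 < p by exact: lt_le_trans p1.
have -> : 2^-1 * (\sum_(i < n) 1 / (m i)%:R `^ p) `^ p^-1 =
    pnorm p (\row_i (2 * (m i)%:R)^-1).
  rewrite /pnorm [in RHS](eq_bigr (fun i => 2^-1 `^ p * (1 / (m i)%:R `^ p))).
    rewrite -[in RHS]mulr_sumr [RHS]powRM ?powR_ge0//; last first.
      by apply: sumr_ge0 => i _; rewrite divr_ge0 ?powR_ge0.
    by rewrite -powRrM mulfV ?gt_eqF// powRr1// invr_ge0.
  move=> i _; rewrite mxE ger0_norm ?invr_ge0 ?mulr_ge0//.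
  rewrite invfM powRM ?invr_ge0//.
  by rewrite (@powRV _ _ (m i)%:R)// mul1r.
apply: lb_le_inf => // _ [j _ <-]; apply: (le_pnorm p1) => i; rewrite !mxE.
have M0 : 0 < (m i)%:R :> R by rewrite ltr0n.
have -> : (2 * (m i)%:R)^-1 - (j i)%:R / (m i)%:R =
    (2 * (m i)%:R)^-1 * (1 - 2 * (j i)%:R) :> R.
  by field; rewrite gt_eqF.
(* The factor [1 - 2 * (j i)%:R] is an odd integer, so its absolute value is at least 1. *)
rewrite normrM ler_peMr//.
case: (j i) => [|k]; first by rewrite mulr0 subr0 normr1.
have k0 : 0 <= k%:R :> R by [].
by rewrite -natr1 ler_normr; apply/orP; right; lra.
Qed.

Lemma comp_node_dist_C_class (Omega : R -> R) : MC_type Omega ->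
  C_class p Omega (Omega \o node_dist).
Proof.
move=> O_MC; have [_ O_mono _ _] := O_MC.
have O_lip x y c : pnorm p (x - y) <= c ->
    `|(Omega \o node_dist) x - (Omega \o node_dist) y| <= Omega c.
  move=> xyc; apply: le_trans (MC_dist_le O_MC _ _) _; rewrite ?node_dist_ge0//.
  by apply: O_mono => //; exact: le_trans (node_dist_lipschitz x y) xyc.
split; last first.
  by move=> c _; apply: ge_ereal_sup => _ [x [y [_ _ xyc ->]]];
    rewrite lee_fin O_lip.
apply: continuous_subspaceT => a.
apply/(@cvgrPdist_lt R R 'rV[R]_n (nbhs a) (nbhs_filter a)) => e e0.
have [d d0 de] := MC_small O_MC e0.
(* The added 1 makes this Lipschitz constant positive for every [n], so that it can be divided
   by. *)
pose c : R := n%:R `^ p^-1 + 1.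
have c0 : 0 < c by rewrite ltr_wpDl ?powR_ge0.
have dc0 : 0 < d / c by rewrite divr_gt0.
apply: filterS (nbhsx_ballx a _ dc0) => x; rewrite -ball_normE/= => ax.
apply: le_lt_trans de; apply: O_lip.
apply: le_trans (pnorm_le_norm p1 _) _.
apply: (@le_trans _ _ (c * `|a - x|)); first by rewrite ler_wpM2r// lerDl.
by rewrite mulrC -ler_pdivlMr// ltW.
Qed.

End extremal_function.

(** * Product weights and the upper bound *)

Lemma sum_prod_eq1 (R : realType) (I J : finType) (w : I -> J -> R) :
  (forall i, \sum_b w i b = 1) ->
  \sum_(l : {ffun I -> J}) \prod_i w i (l i) = 1.
Proof. by move=> w1; rewrite -bigA_distr_bigA big1. Qed.

(* Linearity of the expectation under a product measure. *)
Lemma sum_prod_sum (R : realType) (I J : finType) (w c : I -> J -> R) :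
  (forall i, \sum_b w i b = 1) ->
  \sum_(l : {ffun I -> J}) (\prod_i w i (l i)) * (\sum_i c i (l i)) =
  \sum_i \sum_b w i b * c i b.
Proof.
move=> w1; under eq_bigr do rewrite mulr_sumr.
rewrite exchange_big; apply: eq_bigr => i _ /=.
(* Absorbing [c i] into the factor of index [i] makes the summand a pure product; every other factor
   then sums to 1. *)
pose u k b := w k b * (if k == i then c k b else 1).
transitivity (\sum_(l : {ffun I -> J}) \prod_k u k (l k)).
  apply: eq_bigr => l _; rewrite /u big_split/=; congr (_ * _).
  by rewrite -big_mkcond/= big_pred1_eq.
rewrite -bigA_distr_bigA (bigD1 i)//= [X in _ * X]big1 ?mulr1 => [|k ki].
  by apply: eq_bigr => b _; rewrite /u eqxx.
by rewrite -[RHS](w1 k); apply: eq_bigr => b _; rewrite /u (negbTE ki) mulr1.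
Qed.

Lemma spline_error_le (R : realType) (n : nat) (p : R) (Omega : R -> R)
    (m : 'I_n -> nat) (f : 'rV[R]_n -> R) (x : 'rV[R]_n) :
  1 <= p <= 3 -> MC_type Omega -> concave_on `[0, +oo[ Omega ->
  (forall i, (0 < m i)%N) -> C_class p Omega f -> cube x ->
  `|f x - spline m f x| <=
    Omega (2^-1 * (\sum_(i < n) 1 / (m i)%:R `^ p) `^ p^-1).
Proof.
move=> p13 O_MC O_concave m0 fO Dx; have /andP[p1 _] := p13.
have p0 : 0 < p by exact: lt_le_trans p1.
have [_ O_mono _ _] := O_MC.
have [jm Bx] := cube_block m0 Dx.
set j := block_index m x in jm Bx *.
(* The weight of the lower endpoint in direction [i], that is, 1 minus the local coordinate. *)
pose h i := hat false (m i) (j i) (x ord0 i).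
have M0 i : 0 < (m i)%:R :> R by rewrite ltr0n.
have MN0 i : (m i)%:R != 0 :> R by rewrite gt_eqF.
have h01 i : 0 <= h i <= 1.
  have /andP[lo up] := Bx i.
  have -> : h i = (j i)%:R + 1 - (m i)%:R * x ord0 i.
    by rewrite /h /hat -natr1; field.
  move: lo up; rewrite ler_pdivrMr// ler_pdivlMr// -natr1 ![x ord0 i * _]mulrC.
  by lra.
pose w i (b : bool) := hat b (m i) (j i) (x ord0 i).
have w0 i b : 0 <= w i b.
  by have := h01 i; rewrite /w; case: b; rewrite /h /hat; lra.
have w1 i : \sum_b w i b = 1.
  by rewrite big_bool /w /hat /= subrK.
pose W (l : {ffun 'I_n -> bool}) := \prod_i w i (l i).
pose v (l : {ffun 'I_n -> bool}) := node R m (fun i => j i + l i)%N.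
have W0 l : 0 <= W l by apply: prodr_ge0.
have W1 : \sum_l W l = 1 by exact: sum_prod_eq1.
have Dv l : cube (v l).
  move=> i; rewrite mxE divr_ge0 ?ler0n//= ler_pdivrMr// mul1r ler_nat.
  by have := jm i; case: (l i); rewrite ?addn0 ?addn1// => /ltnW.
(* In each direction the distance to a vertex is the weight of the opposite endpoint times the mesh
   size; this produces the two-point sums h (1 - h)^p + (1 - h) h^p. *)
have xv l i : `|(x - v l) ord0 i| = w i (~~ l i) / (m i)%:R.
  rewrite -[RHS]ger0_norm ?divr_ge0 ?w0 ?ler0n// !mxE /w /hat.
  case: (l i) => /=; last by rewrite addn0 -natr1; congr `|_|; field.
  by rewrite distrC addn1 -natr1; congr `|_|; field.
have -> : f x - spline m f x = \sum_l W l * (f x - f (v l)).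
  under eq_bigr do rewrite mulrBr.
  rewrite big_split/= -mulr_suml W1 mul1r sumrN; congr (_ - _).
  by apply: eq_bigr => l _; rewrite mulrC.
apply: le_trans (ler_norm_sum _ _ _) _.
apply: (@le_trans _ _ (\sum_l W l * Omega (pnorm p (x - v l)))).
  apply: ler_sum => l _; rewrite normrM (ger0_norm (W0 l)).
  by rewrite ler_wpM2l// (C_class_le p1 fO).
have d0 l : 0 <= pnorm p (x - v l) by exact: pnorm_ge0.
(* Jensen for the convex function [- Omega]. *)
apply: (@le_trans _ _ (Omega (\sum_l W l * pnorm p (x - v l)))).
  rewrite -lerN2; apply: le_trans (jensen O_concave W0 d0 W1) _.
  by rewrite -sumrN; apply: ler_sum => l _; rewrite mulrN.
have S0 : 0 <= \sum_(i < n) 1 / (m i)%:R `^ p.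
  by apply: sumr_ge0 => i _; rewrite divr_ge0 ?powR_ge0.
apply: O_mono; first by apply: sumr_ge0 => l _; rewrite mulr_ge0.
(* Comparing p-th powers lets Jensen for t^p replace the distances by sums over the coordinates. *)
rewrite -(ler_powR2r p0); [|by apply: sumr_ge0 => l _; rewrite mulr_ge0|
  by rewrite mulr_ge0 ?powR_ge0// invr_ge0].
rewrite [leRHS]powRM ?powR_ge0 ?invr_ge0//.
rewrite -[X in _ <= _ * X]powRrM mulVf ?gt_eqF// powRr1//.
apply: le_trans (jensen (convex_powR p1) W0 d0 W1) _.
under eq_bigr do rewrite (powR_pnorm p1).
under eq_bigr do under eq_bigr do rewrite xv.
(* Each summand depends on one coordinate of [l], so the average over all vertices splits into one
   two-point average per direction. *)
rewrite (sum_prod_sum (fun i b => (w i (~~ b) / (m i)%:R) `^ p) w1) mulr_sumr.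
apply: ler_sum => i _; rewrite big_bool.
have := two_point_powR_le (h01 i) p13.
rewrite -[1 - h i]/(w i true) -[h i]/(w i false) [~~ true]/= [~~ false]/=.
move: (w i true) (w i false) (w0 i true) (w0 i false) => a b a0 b0 ab.
rewrite !powRM ?invr_ge0// powRV// mul1r !mulrA /= -mulrDl.
by rewrite ler_wpM2r ?invr_ge0 ?powR_ge0// addrC.
Qed.

Theorem theorem2 (R : realType) (n : nat) (p : R) (Omega : R -> R)
    (n_ge1 : (1 <= n)%N) (p_bounds : 1 <= p <= 3)
    (Omega_MC : MC_type Omega) (Omega_concave : concave_on `[0, +oo[ Omega)
    (m : 'I_n -> nat) (m_ge2 : forall i, (2 <= m i)%N) :
  class_error m (C_class p Omega) =
    (Omega (2^-1 * (\sum_(i < n) 1 / (m i)%:R `^ p) `^ p^-1))%:E.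
Proof.
have m0 i : (0 < m i)%N by exact: ltnW (m_ge2 i).
have /andP[p1 _] := p_bounds.
have [at0 O_mono _ _] := Omega_MC.
apply/eqP; rewrite eq_le; apply/andP; split.
  apply: ge_ereal_sup => _ [f fO <-]; apply: ge_ereal_sup => _ [x Dx <-].
  by rewrite lee_fin spline_error_le.
set d := node_dist (p := p) (m := m).
apply: (@le_trans _ _ (max_error m (Omega \o d))); last first.
  apply: ereal_sup_ubound; exists (Omega \o d) => //.
  exact: comp_node_dist_C_class.
pose c : 'rV[R]_n := \row_i (2 * (m i)%:R)^-1.
have Dc : cube c.
  move=> i; rewrite mxE invr_ge0 mulr_ge0//=.
  by rewrite invf_le1 -natrM ?ler1n ?ltr0n muln_gt0 m0.
apply: (@le_trans _ _ (`|(Omega \o d) c - spline m (Omega \o d) c|%:E));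
  last first.
  by apply: ereal_sup_ubound; exists c.
(* The spline only sees values at nodes, where [d] is 0 and hence [Omega \o d] is 0. *)
have -> : spline m (Omega \o d) c = 0.
  by apply: big1 => l _; rewrite /d /= node_dist_node// at0 mul0r.
rewrite subr0 lee_fin ger0_norm ?(MC_ge0 Omega_MC) ?node_dist_ge0//.
apply: O_mono; last exact: node_dist_center.
by rewrite mulr_ge0 ?powR_ge0// invr_ge0.
Qed.
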